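(* Let $n\ge1$ be an integer and $s\in(0,1)$. The constant $$C(n,s):=\Big(\int_{\mathbb{R}^n}\frac{1-\cos(\eta_1)}{|\eta|^{n+2s}}\,d\eta\Big)^{-1},$$ where $\eta_1$ is the first coordinate of $\eta\in\mathbb{R}^n$, is given by $$C(n,s)=\frac{2^{2s}\,s\,\Gamma\left(\frac n2+s\right)}{\pi^{\frac n2}\,\Gamma(1-s)}.$$
   Context: $\Gamma$ is the Euler Gamma function. The constant $C(n,s)$ is the normalization constant in the definition of the fractional Laplacian, $(-\Delta)^su(x)=C(n,s)\,\mathrm{P.V.}\int_{\mathbb{R}^n}\frac{u(x)-u(y)}{|x-y|^{n+2s}}\,dy$. *)

(* Defs.v *)
From HB Require Import structures.
From mathcomp Require Import all_boot all_order all_algebra.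
From mathcomp Require Import all_classical all_reals all_analysis.

Set Implicit Arguments.
Unset Strict Implicit.
Unset Printing Implicit Defensive.

Import Order.TTheory GRing.Theory Num.Theory.
Import numFieldNormedType.Exports.

Local Open Scope classical_set_scope.
Local Open Scope ring_scope.

Section lebesgue_tuple.
Context (R : realType).
Local Notation T := (measurableTypeR R).

Section step.
Context (n : nat) (mu : {sigma_finite_measure set (n.-tuple T) -> \bar R}).

Definition tuple_cons (p : T * n.-tuple T) : n.+1.-tuple T :=
  [tuple of p.1 :: p.2].

Lemma measurable_tuple_cons : measurable_fun setT tuple_cons.
Proof. exact: (measurable_cons measurable_fst measurable_snd). Qed.

Definition lebesgue_tupleS : set (n.+1.-tuple T) -> \bar R :=
  pushforward (@lebesgue_measure R \x mu)%E tuple_cons.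

Let pushed : {measure set (n.+1.-tuple T) -> \bar R}.
Proof.
pose m := measure_function_pushforward__canonical__measure_function_Measure.
exact: (m _ _ _ _ _ (@lebesgue_measure R \x mu)%E _ measurable_tuple_cons).
Defined.

HB.instance Definition _ := isMeasure.Build _ _ _ lebesgue_tupleS
  (measure0 pushed) (measure_ge0 pushed)
  (@measure_semi_sigma_additive _ _ _ pushed).

Let uncons (t : n.+1.-tuple T) : T * n.-tuple T := (thead t, [tuple of behead t]).

Let measurable_uncons : measurable_fun setT uncons.
Proof.
by apply/measurable_fun_pair; [exact: measurable_tnth | exact: measurable_behead].
Qed.

Let lebesgue_tupleS_sigma_finite : sigma_finite setT lebesgue_tupleS.
Proof.
have /sigma_finiteP[F [TF ndF Foo]] := sigma_finiteT (@lebesgue_measure R).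
have /sigma_finiteP[G [TG ndG Goo]] := sigma_finiteT mu.
exists (fun k => uncons @^-1` (F k `*` G k)).
  apply/esym/seteqP; split=> // t _.
  have [i _ Fi] : (\bigcup_i F i) (thead t) by rewrite -TF.
  have [j _ Gj] : (\bigcup_j G j) [tuple of behead t] by rewrite -TG.
  exists (maxn i j) => //; split.
  - by move: Fi; exact/subsetPset/ndF/leq_maxl.
  - by move: Gj; exact/subsetPset/ndG/leq_maxr.
move=> k; have [mFk Fk] := Foo k; have [mGk Gk] := Goo k.
have mFGk : measurable (F k `*` G k) by exact: measurableX.
split; first by rewrite -[X in measurable X]setTI; exact: measurable_uncons.
rewrite /lebesgue_tupleS /pushforward -comp_preimage.
have -> : uncons \o tuple_cons = id.
  by apply/funext => -[x t]; congr pair => //; exact: val_inj.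
by rewrite product_measure1E// lte_mul_pinfty// ge0_fin_numE.
Qed.

HB.instance Definition _ := Measure_isSigmaFinite.Build _ _ _ lebesgue_tupleS
  lebesgue_tupleS_sigma_finite.

End step.

(* The n-dimensional Lebesgue measure on R^n = n.-tuple R. *)
Fixpoint lebesgue_tuple (n : nat) :
    {sigma_finite_measure set (n.-tuple T) -> \bar R} :=
  match n with
  | 0 => @dirac _ (0.-tuple T) [tuple] R
  | m.+1 => lebesgue_tupleS (lebesgue_tuple m)
  end.

(* Sanity check: the volume of a box is the product of the measures of its
   sides. *)
Lemma lebesgue_tuple_box (n : nat) (A : 'I_n -> set T) :
  (forall i, measurable (A i)) ->
  lebesgue_tuple n [set t | forall i, A i (tnth t i)] =
  (\prod_(i < n) @lebesgue_measure R (A i))%E.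
Proof.
elim: n A => [|n IHn] A mA /=.
  by rewrite big_ord0 diracE mem_set// => -[].
rewrite /lebesgue_tupleS /pushforward big_ord_recl -IHn//.
rewrite -product_measure1E//.
- congr (product_measure1 _ _ _); apply/seteqP; split=> -[x t] /=.
    move=> At; split=> [|i]; first exact: (At ord0).
    by have := At (lift ord0 i); rewrite tnthS.
  by move=> [Ax At] i; have [j ->|->] := unliftP ord0 i; rewrite ?tnthS.
- rewrite (_ : mkset _ = \bigcap_(i in [set: 'I_n])
      ((@tnth _ T ^~ i) @^-1` A (lift ord0 i))); last first.
    by apply/seteqP; split=> t /= At i; [move=> _|]; exact: At.
  apply: fin_bigcap_measurable => // i _.
  by rewrite -[X in measurable X]setTI; exact: measurable_tnth.
Qed.

End lebesgue_tuple.
Arguments lebesgue_tuple {R} n.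

Definition eucl_norm (R : realType) (n : nat) (x : n.-tuple R) : R :=
  Num.sqrt (\sum_(i < n) tnth x i ^+ 2).

Definition Gamma (R : realType) (x : R) : R :=
  \int[lebesgue_measure]_(t in `]0, +oo[) (t `^ (x - 1) * expR (- t)).

(* For 0 < n, eta`_0 is the first coordinate of eta. *)
Definition C (R : realType) (n : nat) (s : R) : R :=
  (\int[lebesgue_tuple n]_eta
     ((1 - cos (eta`_0 : R)) / eucl_norm eta `^ (n%:R + 2 * s)))^-1.

(* Main.v *)
Require Import Defs.
From HB Require Import structures.
From mathcomp Require Import all_boot all_order all_algebra.
From mathcomp Require Import all_classical all_reals all_analysis.
From mathcomp Require Import measurable_realfun.
From mathcomp Require Import ring lra.

Import Order.TTheory GRing.Theory Num.Theory.
Import numFieldNormedType.Exports.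

Local Open Scope classical_set_scope.
Local Open Scope ring_scope.

(** Subordination: with [p = n/2 + s] and [|x|] the Euclidean norm,
    [Gamma p / |x|^(2p)] is the integral over [t > 0] of [t^(p-1) e^(-t|x|^2)].
    By Tonelli the integral of [(1 - cos x_0) / |x|^(n+2s)] becomes a [t]-integral
    of Gaussian integrals over R^n, which factor into one-dimensional ones.
    Expanding the cosine in power series, the integral over R of
    [(1 - cos x) e^(-tx^2)] is [sqrt (pi/t) (1 - e^(-1/(4t)))], so what remains is
    [pi^(n/2)] times the integral over [t > 0] of [t^(s-1) (1 - e^(-1/(4t)))].
    Writing [1 - e^(-1/(4t))] as the integral of [e^(-v)] over [0 < v < 1/(4t)]
    and exchanging once more gives [4^(-s) Gamma(1-s) / s]. *)

(** * Tonelli on products of sets, and scaling *)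

(** Extending [f] by zero off [D1 x D2] reduces this to Tonelli on the whole product, so the sign of
    [f] matters only on [D1 x D2]. *)
Lemma ge0_tonelli_in {d1 d2 : measure_display} {T1 : measurableType d1}
    {T2 : measurableType d2} {R : realType}
    (m1 : {sigma_finite_measure set T1 -> \bar R})
    (m2 : {sigma_finite_measure set T2 -> \bar R})
    (D1 : set T1) (D2 : set T2) (f : T1 * T2 -> \bar R) :
  measurable D1 -> measurable D2 -> measurable_fun [set: T1 * T2] f ->
  (forall x y, D1 x -> D2 y -> 0 <= f (x, y))%E ->
  (\int[m1]_(x in D1) \int[m2]_(y in D2) f (x, y) =
   \int[m2]_(y in D2) \int[m1]_(x in D1) f (x, y))%E.
Proof.
move=> mD1 mD2 mf f0.
have mD : measurable (D1 `*` D2) by exact: measurableX.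
pose g := f \_ (D1 `*` D2).
have mg : measurable_fun setT g.
  by rewrite /g; apply/(measurable_restrictT f mD)/measurable_funTS.
have g0 z : (0 <= g z)%E.
  case: z => x y; rewrite /g patchE; case: ifPn => //.
  by rewrite in_setX => /andP[/set_mem D1x /set_mem D2y]; exact: f0.
transitivity (\int[m1]_x \int[m2]_y g (x, y))%E.
  rewrite integral_mkcond; apply: eq_integral => x _.
  rewrite patchE; case: ifPn => xD1.
    rewrite integral_mkcond; apply: eq_integral => y _.
    by rewrite /g !patchE in_setX xD1.
  by rewrite integral0_eq// => y _; rewrite /g patchE in_setX (negbTE xD1).
rewrite fubini_tonelli//.
rewrite [RHS]integral_mkcond; apply: eq_integral => y _.
rewrite patchE; case: ifPn => yD2.
  rewrite [RHS]integral_mkcond; apply: eq_integral => x _.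
  by rewrite /g !patchE in_setX yD2 andbT.
by rewrite integral0_eq// => x _; rewrite /g patchE in_setX (negbTE yD2) andbF.
Qed.

Section half_line.
Context {R : realType}.
Local Notation mu := (@lebesgue_measure R).

(** The half-line is its own preimage under multiplication by [c], and the image of Lebesgue measure
    under that map is [c^-1] times Lebesgue measure. *)
Lemma ge0_integral_scale (c : R) (f : R -> \bar R) :
  0 < c -> measurable_fun setT f -> (forall x : R, 0 < x -> (0 <= f x)%E) ->
  (\int[mu]_(x in `]0%R, +oo[) f (c * x)%R =
   c^-1%:E * \int[mu]_(x in `]0%R, +oo[) f x)%E.
Proof.
move=> c0 mf f0.
have c0' : 0 <= c^-1 by rewrite invr_ge0 ltW.
pose phi : measurableTypeR R -> measurableTypeR R := *%R c.
have mphi : measurable_fun setT phi by exact: mulrl_measurable.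
have phiE : `]0, +oo[%classic = phi @^-1` `]0, +oo[.
  by apply/seteqP; split=> x; rewrite /phi/= !in_itv/= !andbT pmulr_rgt0.
rewrite [in LHS]phiE -(@ge0_integral_pushforward _ _ _ _ _ _ mphi)//; last 2 first.
- exact: measurable_funTS.
- by move=> x; rewrite inE/= in_itv/= andbT => x0; exact: f0.
rewrite -[c^-1]/((NngNum c0')%:num) -ge0_integral_mscale//; last 2 first.
- exact: measurable_funTS.
- by move=> x/=; rewrite in_itv/= andbT => x0; exact: f0.
have c0W : 0 <= c by exact: ltW.
pose m0 := measure_function_pushforward__canonical__measure_function_Measure
  mu mphi.
(* The preimage of []a, b]] has length [(b - a) / c]; agreement on such intervals determines the
   measure. *)
have H A : measurable A -> mu A = mscale (NngNum c0W) m0 A.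
  move=> mA; apply: lebesgue_measure_unique => //= _ [[a b]] _ <-.
  rewrite /mscale/= /pushforward.
  have -> : phi @^-1` `]a, b] = `](a / c), (b / c)]%classic.
    apply/seteqP; split=> x; rewrite /phi/= !in_itv/=.
      by rewrite ltr_pdivrMr// ler_pdivlMr// mulrC.
    by rewrite ltr_pdivrMr// ler_pdivlMr// mulrC.
  rewrite !lebesgue_measure_itv/= !lte_fin ltr_pM2r ?invr_gt0//.
  case: ifPn => // _; rewrite ?mule0// -EFinM -mulrBl mulrC divfK//.
  by rewrite gt_eqF.
apply: eq_measure_integral => A mA _.
change (m0 A = (c^-1)%:E * mu A)%E.
have muA : mu A = (c%:E * m0 A)%E := H A mA.
by rewrite muA muleA -EFinM mulVf ?gt_eqF// mul1e.
Qed.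

End half_line.

(** * Power, exponential and Gamma integrals *)

Lemma cvg_divSn0r {R : realType} (b : R) : 0 < b -> b / n.+1%:R @[n --> \oo] --> 0^'+.
Proof.
move=> b0.
have u0 : b / n.+1%:R @[n --> \oo] --> 0.
  by rewrite -(mulr0 b); apply: cvgMr; exact: cvg_harmonic.
move=> A hA; have : \forall n \near \oo, 0 < b / n.+1%:R -> A (b / n.+1%:R).
  exact: (u0 _ hA).
by apply: filterS => n; apply; rewrite divr_gt0.
Qed.

Lemma derivable_powRDr {R : realType} (s x : R) : s != 0 -> 0 < x ->
  derivable (fun y => y `^ s / s) x 1 /\
  (fun y => y `^ s / s)^`()%classic x = x `^ (s - 1).
Proof.
move=> s0 x0.
have xin : x \in `]0, +oo[ by rewrite in_itv/= x0.
have dx : derivable (@powR R ^~ s) x 1 by exact: derivable_powR.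
split.
  by apply: derivableM => //; exact: derivable_cst.
rewrite derive1Mr//.
by rewrite powR_derive1// mulrAC mulfV// mul1r.
Qed.

Section powR_integral.
Context {R : realType}.
Local Notation mu := (@lebesgue_measure R).

Lemma integral_powR_itv (s a b : R) : s != 0 -> 0 < a < b ->
  (\int[mu]_(x in `[a, b[) (x `^ (s - 1))%:E = (b `^ s / s - a `^ s / s)%:E)%E.
Proof.
move=> s0 /andP[a0 ab]; have b0 := lt_trans a0 ab.
rewrite integral_itv_bndo_bndc; last first.
  by apply/measurable_EFinP/measurable_funTS; exact: measurable_powR.
have dF x : 0 < x -> derivable (fun y => y `^ s / s) x 1.
  by move=> x0; have [] := derivable_powRDr _ _ s0 x0.
have cF x : 0 < x -> {for x, continuous (fun y => y `^ s / s)}.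
  by move=> x0; apply/differentiable_continuous/derivable1_diffP; exact: dF.
rewrite EFinB; apply: (@continuous_FTC2 R _ (fun y => y `^ s / s)) => //.
- apply: derivable_within_continuous => x; rewrite in_itv/= => /andP[ax _].
  by apply: derivable_powR; rewrite in_itv/= (lt_le_trans a0).
- split.
  + by move=> x; rewrite in_itv/= => /andP[ax _]; apply: dF; exact: lt_trans ax.
  + by apply: cvg_at_right_filter; exact: cF.
  + by apply: cvg_at_left_filter; exact: cF.
- move=> x; rewrite in_itv/= => /andP[ax _].
  by have [] := derivable_powRDr _ _ s0 (lt_trans a0 ax).
Qed.

Lemma integral0_powR (s b : R) : 0 < s -> 0 < b ->
  (\int[mu]_(x in `]0%R, b[) (x `^ (s - 1))%:E = (b `^ s / s)%:E)%E.
Proof.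
move=> s0 b0.
(* Halving [b] makes [a n < b] strict already at [n = 0]. *)
pose a n := b / 2 / n.+1%:R.
have a0 n : 0 < a n by rewrite !divr_gt0.
have ab n : a n < b.
  rewrite /a ltr_pdivrMr// (@lt_le_trans _ _ b)//.
    by rewrite ltr_pdivrMr// ltr_pMr// ltr1n.
  by rewrite ler_peMr ?ler1n// ltW.
have a0r : a n @[n --> \oo] --> 0^'+ by apply: cvg_divSn0r; rewrite divr_gt0.
pose F n := `[a n, b[%classic.
have UF : \bigcup_n F n = `]0, b[%classic.
  apply/seteqP; split=> x.
    move=> [n _]; rewrite /F/= !in_itv/= => /andP[ax ->].
    by rewrite (lt_le_trans _ ax).
  rewrite /= in_itv/= => /andP[x0 xb].
  have : \forall n \near \oo, a n < x.
    exact: (a0r _ (nbhs_right_lt x0)).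
  move=> [n _ an]; exists n => //.
  by rewrite /F/= in_itv/= xb andbT ltW// an/=.
have cv : (\int[mu]_(x in F n) (x `^ (s - 1))%:E @[n --> \oo] -->
    \int[mu]_(x in `]0%R, b[) (x `^ (s - 1))%:E)%E.
  rewrite -UF; apply: ge0_nondecreasing_set_cvg_integral.
  - move=> m n mn; apply/subsetPset => x; rewrite /F/= !in_itv/=.
    move=> /andP[ax ->]; rewrite andbT (le_trans _ ax)// /a.
    by rewrite ler_pM2l ?divr_gt0// lef_pV2 ?posrE// ler_nat.
  - by move=> n; exact: measurable_itv.
  - move=> n; apply/measurable_EFinP/measurable_funTS; exact: measurable_powR.
  - by move=> n x _; rewrite lee_fin powR_ge0.
apply: (cvg_unique _ cv) => //.
have -> : (fun n => \int[mu]_(x in F n) (x `^ (s - 1))%:E)%E =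
    (fun n => (b `^ s / s - a n `^ s / s)%:E).
  by apply/funext => n; rewrite /F integral_powR_itv ?gt_eqF// a0 ab.
apply: cvg_EFin; first by near=> n.
rewrite -[X in _ --> X]subr0; apply: cvgB; first exact: cvg_cst.
rewrite -(mul0r s^-1); apply: cvgMl.
have := @powR_cvg0 R _ s0.
exact: (cvg_comp _ _ a0r).
Unshelve. all: by end_near. Qed.

End powR_integral.

Lemma is_derive_continuous {R : realType} (f f' : R -> R) :
  (forall x : R, is_derive x (1 : R) f (f' x)) -> continuous f.
Proof.
by move=> df x; apply/differentiable_continuous/derivable1_diffP; have [] := df x.
Qed.

Section exponential_integrals.
Context {R : realType}.
Local Notation mu := (@lebesgue_measure R).

(** The primitive [- expR (- g)] tends to 0 at infinity. Linear and quadratic [g] give the two tail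
    integrals that follow. *)
Lemma integral_expRN_comp (g g' : R -> R) (a : R) :
  (forall x : R, is_derive x (1 : R) g (g' x)) -> continuous g' ->
  (forall x, a <= x -> 0 <= g' x) -> g x @[x --> +oo] --> +oo ->
  (\int[mu]_(x in `[a, +oo[) (g' x * expR (- g x))%:E = (expR (- g a))%:E)%E.
Proof.
move=> dg cg' g'0 gy.
have dF (x : R) : is_derive x (1 : R) (fun y => - expR (- g y)) (g' x * expR (- g x)).
  apply: is_derive_eq; rewrite /GRing.scale/=; ring.
have dE (x : R) : is_derive x (1 : R) (fun y => expR (- g y)) (- (g' x * expR (- g x))).
  apply: is_derive_eq; rewrite /GRing.scale/=; ring.
rewrite (@ge0_continuous_FTC2y R _ (fun y => - expR (- g y)) a 0).
- by rewrite -EFinB sub0r opprK.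
- by move=> x ax; rewrite mulr_ge0 ?expR_ge0 ?g'0.
- apply: continuous_subspaceT => x; apply: cvgM; first exact: cg'.
  exact: is_derive_continuous dE x.
- rewrite -oppr0; apply: cvgN.
  exact: (cvg_comp _ _ gy (@cvgr_expR R)).
- by move=> x _; have [] := dF x.
- by apply: cvg_at_right_filter; exact: is_derive_continuous dF a.
- by move=> x _; rewrite derive1E; have [] := dF x.
Qed.

Lemma integral_expRN (c a : R) : 0 < c ->
  (\int[mu]_(x in `[a, +oo[) (expR (- (c * x)))%:E = (c^-1 * expR (- (c * a)))%:E)%E.
Proof.
move=> c0.
have dg (x : R) : is_derive x (1 : R) ( *%R c) ((fun=> c) x).
  by apply: is_derive_eq; rewrite /GRing.scale/= mulr1.
rewrite EFinM -(@integral_expRN_comp _ (fun=> c) a dg); last 3 first.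
- by move=> x; exact: cst_continuous.
- by move=> x _; exact: ltW.
- by apply: gt0_cvgMry => //; exact: cvg_id.
rewrite -ge0_integralZl_EFin//=; last 3 first.
- by move=> x _; rewrite lee_fin mulr_ge0 ?expR_ge0// ltW.
- apply/measurable_EFinP/measurable_funTS/measurable_funM => //.
  apply: measurableT_comp => //.
  by apply: measurableT_comp => //; exact: mulrl_measurable.
- by rewrite invr_ge0 ltW.
by apply: eq_integral => x _; rewrite -EFinM mulKf// gt_eqF.
Qed.

Lemma integral_mulr_expRN_sqr (t a : R) : 0 < t -> 0 <= a ->
  (\int[mu]_(x in `[a, +oo[) (x * expR (- (t * x ^+ 2)))%:E =
   ((2 * t)^-1 * expR (- (t * a ^+ 2)))%:E)%E.
Proof.
move=> t0 a0.
have dg (x : R) : is_derive x (1 : R) (fun y => t * y ^+ 2) ((fun y => 2 * t * y) x).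
  by apply: is_derive_eq; rewrite /GRing.scale/=; ring.
have tt0 : 0 < 2 * t by rewrite mulr_gt0.
rewrite EFinM -(@integral_expRN_comp _ (fun y => 2 * t * y) a dg); last 3 first.
- by move=> x; apply: cvgM; [exact: cst_continuous|exact: cvg_id].
- by move=> x ax; rewrite mulr_ge0// ?(ltW tt0)// (le_trans a0).
- by apply: gt0_cvgMry => //; exact: cvgr_expr2.
rewrite -ge0_integralZl_EFin//=; last 3 first.
- move=> x; rewrite in_itv/= andbT => ax.
  by rewrite lee_fin !mulr_ge0 ?expR_ge0 ?(ltW t0)// (le_trans a0).
- apply/measurable_EFinP/measurable_funTS; apply: measurable_funM => //.
  apply: measurableT_comp => //; apply: measurableT_comp => //.
  by apply: measurable_funM => //; exact: exprn_measurable.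
- by rewrite invr_ge0 ltW.
by apply: eq_integral => x _; rewrite -EFinM -[2 * t * x * _]mulrA mulKf ?gt_eqF.
Qed.

Lemma integral0_expRN (b : R) : 0 < b ->
  (\int[mu]_(x in `]0%R, b[) (expR (- x))%:E = (1 - expR (- b))%:E)%E.
Proof.
move=> b0.
have mexp (A : set R) : measurable_fun A (EFin \o (fun x : R => expR (- x))).
  apply/measurable_EFinP/measurable_funTS.
  by apply: measurableT_comp => //; exact: oppr_measurable.
rewrite integral_itv_bndo_bndc// integral_itv_obnd_cbnd//.
have dF (x : R) : is_derive x (1 : R) (fun y => - expR (- y)) (expR (- x)).
  by apply: is_derive_eq; rewrite /GRing.scale/=; ring.
have dE (x : R) : is_derive x (1 : R) (fun y => expR (- y)) (- expR (- x)).
  by apply: is_derive_eq; rewrite /GRing.scale/=; ring.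
rewrite (@continuous_FTC2 R _ (fun y => - expR (- y)))//.
- by rewrite oppr0 expR0 -EFinB opprK addrC.
- by apply: continuous_subspaceT; exact: is_derive_continuous dE.
- split.
  + by move=> x _; have [] := dF x.
  + by apply: cvg_at_right_filter; exact: is_derive_continuous dF _.
  + by apply: cvg_at_left_filter; exact: is_derive_continuous dF _.
- by move=> x _; rewrite derive1E; have [] := dF x.
Qed.

End exponential_integrals.

Section Gamma_integral.
Context {R : realType}.
Local Notation mu := (@lebesgue_measure R).
Implicit Types (p t a : R).

Let Gf p t := t `^ (p - 1) * expR (- t).

Let Gf_ge0 p t : 0 <= Gf p t.
Proof. by rewrite mulr_ge0 ?powR_ge0 ?expR_ge0. Qed.

Let measurable_Gf p : measurable_fun setT (Gf p).
Proof.
apply: measurable_funM; first exact: measurable_powR.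
by apply: measurableT_comp => //; exact: oppr_measurable.
Qed.

(** Half of the exponential absorbs the power: raising [t / (2p) <= e^(t/(2p))] to the power [p]
    gives [t^p <= (2p)^p e^(t/2)]. *)
Let Gf_ub p t : 0 < p -> 1 <= t -> Gf p t <= (2 * p) `^ p * expR (- (2^-1 * t)).
Proof.
move=> p0 t1; have t0 : 0 < t by exact: lt_le_trans t1.
have p20 : 0 < 2 * p by rewrite mulr_gt0.
rewrite /Gf (_ : - t = - (2^-1 * t) - (2^-1 * t)); last by lra.
rewrite expRD mulrA ler_wpM2r ?expR_ge0// expRN ler_pdivrMr ?expR_gt0//.
(* Since [t >= 1], the exponent [p - 1], possibly negative, may be raised to [p]. *)
apply: (@le_trans _ _ (t `^ p)); first by rewrite ler_powR// gerBl.
rewrite (_ : 2^-1 * t = t / (2 * p) * p); last by field; rewrite gt_eqF.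
rewrite expRM -powRM ?expR_ge0 ?(ltW p20)//.
rewrite ge0_ler_powR ?nnegrE ?mulr_ge0 ?expR_ge0 ?(ltW t0) ?(ltW p0) ?(ltW p20)//.
rewrite mulrC -ler_pdivrMr//.
by rewrite (le_trans _ (expR_ge1Dx _))// lerDr.
Qed.

(** Near 0 the integrand is at most [t^(p-1)], and from 1 on [Gf_ub] bounds it by an exponential. *)
Lemma integral_Gamma_lty p : 0 < p ->
  (\int[mu]_(t in `]0%R, +oo[) (t `^ (p - 1) * expR (- t))%:E < +oo)%E.
Proof.
move=> p0; rewrite -/(Gf p _).
have mGf (A : set R) : measurable_fun A (EFin \o Gf p).
  by apply/measurable_EFinP/measurable_funTS; exact: measurable_Gf.
have -> : `]0, +oo[%classic = `]0, 1[%classic `|` `[1, +oo[%classic :> set R.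
  by rewrite -itv_bndbnd_setU// bnd_simp.
rewrite ge0_integral_setU//=; last 3 first.
- exact: mGf.
- by move=> x _; rewrite lee_fin Gf_ge0.
- apply/disj_setPS => x [] /=; rewrite !in_itv/= andbT => /andP[_].
  by rewrite ltNge => /negP.
apply: lte_add_pinfty.
  apply: (@le_lt_trans _ _ (\int[mu]_(t in `]0%R, 1%R[) (t `^ (p - 1))%:E)%E).
    apply: ge0_le_integral => //.
    - by move=> x _; rewrite lee_fin Gf_ge0.
    - exact: mGf.
    - by apply/measurable_EFinP/measurable_funTS; exact: measurable_powR.
    - move=> x /=; rewrite in_itv/= => /andP[x0 _].
      rewrite lee_fin ler_piMr ?powR_ge0//.
      by rewrite -expR0 ler_expR oppr_le0 ltW.
  by rewrite integral0_powR// ltry.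
apply: (@le_lt_trans _ _ (\int[mu]_(t in `[1%R, +oo[)
    (((2 * p) `^ p)%:E * (expR (- (2^-1 * t)))%:E))%E).
  apply: ge0_le_integral => //.
  - by move=> x _; rewrite lee_fin Gf_ge0.
  - exact: mGf.
  - apply/measurable_EFinP/measurable_funTS/measurable_funM => //.
    apply: measurableT_comp => //; apply: measurableT_comp => //.
  - move=> x /=; rewrite in_itv/= andbT => x1.
    by rewrite -EFinM lee_fin Gf_ub.
rewrite ge0_integralZl_EFin//=.
- by rewrite integral_expRN// -EFinM ltry.
- apply/measurable_EFinP/measurable_funTS.
  by apply: measurableT_comp => //; apply: measurableT_comp => //.
- exact: powR_ge0.
Qed.

(** [Gamma] is a real-valued integral, hence a [fine] of the extended one; finiteness makes the two
    agree, so that Tonelli can be used on Gamma integrals. *)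
Lemma integral_Gamma p : 0 < p ->
  (\int[mu]_(t in `]0%R, +oo[) (t `^ (p - 1) * expR (- t))%:E = (Gamma p)%:E)%E.
Proof.
move=> p0; rewrite /Gamma /Rintegral fineK// ge0_fin_numE ?integral_Gamma_lty//.
by apply: integral_ge0 => t _; rewrite lee_fin Gf_ge0.
Qed.

(** On []0, 1[] the exponential is at least [e^(-1)], whence [Gamma p >= e^(-1) / p]. *)
Lemma Gamma_gt0 p : 0 < p -> 0 < Gamma p.
Proof.
move=> p0; rewrite -lte_fin -integral_Gamma//.
apply: (@lt_le_trans _ _
    (\int[mu]_(t in `]0%R, 1%R[) ((expR (- 1))%:E * (t `^ (p - 1))%:E))%E).
  rewrite ge0_integralZl_EFin//= ?expR_ge0//.
  - by rewrite integral0_powR// powR1 -EFinM lte_fin !mulr_gt0 ?invr_gt0 ?expR_gt0.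
  - by move=> t _; rewrite lee_fin powR_ge0.
  - by apply/measurable_EFinP/measurable_funTS; exact: measurable_powR.
apply: (@le_trans _ _ (\int[mu]_(t in `]0%R, 1%R[) (Gf p t)%:E)%E).
  apply: ge0_le_integral => //.
  - by move=> t _; rewrite -EFinM lee_fin mulr_ge0 ?powR_ge0 ?expR_ge0.
  - by apply/measurable_EFinP/measurable_funTS/measurable_funM.
  - by apply/measurable_EFinP/measurable_funTS; exact: measurable_Gf.
  - move=> t /=; rewrite in_itv/= => /andP[t0 t1].
    rewrite -EFinM lee_fin mulrC ler_wpM2l ?powR_ge0// ler_expR lerN2.
    exact: ltW.
apply: ge0_subset_integral => //.
- by apply/measurable_EFinP/measurable_funTS; exact: measurable_Gf.
- by move=> t _; rewrite lee_fin Gf_ge0.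
- by move=> t /=; rewrite !in_itv/= => /andP[->].
Qed.

(** This is the subordination formula, to be used with [a] the squared Euclidean norm. Substituting
    [a * t] produces one factor [a^(1-p)] from the power and one [a^-1] from the measure. *)
Lemma integral_Gamma_scale p a : 0 < p -> 0 < a ->
  (\int[mu]_(t in `]0%R, +oo[) (t `^ (p - 1) * expR (- (a * t)))%:E =
   (Gamma p / a `^ p)%:E)%E.
Proof.
move=> p0 a0.
have ap0 : a `^ (p - 1) != 0 by rewrite gt_eqF// powR_gt0.
transitivity (\int[mu]_(t in `]0%R, +oo[)
    ((a `^ (p - 1))^-1%:E * (Gf p (a * t))%:E))%E.
  apply: eq_integral => t; rewrite inE/= in_itv/= andbT => t0.
  by rewrite -EFinM /Gf powRM ?ltW// -mulrA mulKf.
rewrite ge0_integralZl_EFin//=; last 3 first.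
- by move=> t _; rewrite lee_fin Gf_ge0.
- apply/measurable_EFinP/measurable_funTS.
  by apply: measurableT_comp; [exact: measurable_Gf|exact: mulrl_measurable].
- by rewrite invr_ge0 powR_ge0.
rewrite (@ge0_integral_scale R a (EFin \o Gf p))//; last 2 first.
- by apply/measurable_EFinP; exact: measurable_Gf.
- by move=> t _; rewrite lee_fin Gf_ge0.
rewrite [X in (_ * (_ * X))%E]integral_Gamma// -!EFinM; congr EFin.
by rewrite -(mulr_powRB1 (ltW a0) p0) invfM; ring.
Qed.

End Gamma_integral.

(** * Exchanging integrals over planar regions *)

(** Setting the integrand to zero where [r] fails turns the integrals over sections of the region
    into integrals over a full product. *)
Lemma ge0_tonelli_rel {d1 d2 : measure_display} {T1 : measurableType d1}
    {T2 : measurableType d2} {R : realType}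
    (m1 : {sigma_finite_measure set T1 -> \bar R})
    (m2 : {sigma_finite_measure set T2 -> \bar R})
    (D1 : set T1) (D2 : set T2) (r : T1 * T2 -> bool) (f : T1 * T2 -> \bar R) :
  measurable D1 -> measurable D2 -> measurable_fun [set: T1 * T2] r ->
  measurable_fun [set: T1 * T2] f ->
  (forall x y, D1 x -> D2 y -> r (x, y) -> 0 <= f (x, y))%E ->
  (\int[m1]_(x in D1) \int[m2]_(y in D2 `&` [set y | r (x, y)]) f (x, y) =
   \int[m2]_(y in D2) \int[m1]_(x in D1 `&` [set x | r (x, y)]) f (x, y))%E.
Proof.
move=> mD1 mD2 mr mf f0.
pose g z := if r z then f z else 0%E.
have mg : measurable_fun [set: T1 * T2] g.
  by apply: measurable_fun_ifT => //; exact: measurable_cst.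
transitivity (\int[m1]_(x in D1) \int[m2]_(y in D2) g (x, y))%E.
  apply: eq_integral => x _; rewrite integral_mkcondr.
  by apply: eq_integral => y _; rewrite patchE mem_setE /g unfold_in.
rewrite ge0_tonelli_in//; last first.
  by move=> x y D1x D2y; rewrite /g; case: ifPn => // /f0; exact.
apply: eq_integral => y _; rewrite integral_mkcondr.
by apply: eq_integral => x _; rewrite patchE mem_setE /g unfold_in.
Qed.

Section layer_cake.
Context {R : realType}.
Local Notation mu := (@lebesgue_measure R).

(* Both sides integrate [t^(s-1) e^(-v)] over the region [4 t v < 1]. *)
Lemma integral_powR_onem_expRN (s : R) : 0 < s < 1 ->
  (\int[mu]_(t in `]0%R, +oo[) (t `^ (s - 1) * (1 - expR (- (4 * t)^-1)))%:E =
   (Gamma (1 - s) / (4 `^ s * s))%:E)%E.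
Proof.
move=> /andP[s0 s1].
pose r (z : R * R) := 4 * z.1 * z.2 < 1.
pose f (z : R * R) := (z.1 `^ (s - 1) * expR (- z.2))%:E.
transitivity (\int[mu]_(t in `]0%R, +oo[)
    \int[mu]_(v in `]0%R, +oo[ `&` [set v | r (t, v)]) f (t, v))%E.
  apply: eq_integral => t; rewrite inE/= in_itv/= andbT => t0.
  (* For fixed [t] the section is [0 < v < 1/(4t)], over which [e^(-v)] integrates to
     [1 - e^(-1/(4t))]. *)
  have -> : `]0, +oo[ `&` [set v | r (t, v)] = `]0, (4 * t)^-1[%classic.
    apply/seteqP; split=> v /=; rewrite !in_itv/= andbT /r/=.
      by move=> [-> ?]; rewrite -[X in _ < X]mul1r ltr_pdivlMr ?mulr_gt0// mulrC.
    move=> /andP[-> ?]; split=> //.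
    by rewrite mulrC -ltr_pdivlMr ?mulr_gt0// mul1r.
  rewrite /f/=; under [RHS]eq_integral do rewrite EFinM.
  rewrite ge0_integralZl_EFin//= ?powR_ge0//.
    by rewrite integral0_expRN ?invr_gt0 ?mulr_gt0// -EFinM.
  by apply/measurable_EFinP/measurable_funTS/measurableT_comp.
rewrite ge0_tonelli_rel//=; last 3 first.
- apply: measurable_fun_ltr => //; apply: measurable_funM => //.
  by apply: measurable_funM.
- apply/measurable_EFinP/measurable_funM.
    exact: (measurableT_comp (@measurable_powR R (s - 1)) measurable_fst).
  by apply: measurableT_comp => //; apply: measurableT_comp.
- by move=> t v _ _ _; rewrite /f lee_fin mulr_ge0 ?powR_ge0 ?expR_ge0.
have s10 : 0 < 1 - s by rewrite subr_gt0.
have c0 : 0 <= (4 `^ s * s)^-1 by rewrite invr_ge0 mulr_ge0 ?powR_ge0 ?ltW.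
rewrite mulrC EFinM -integral_Gamma// -ge0_integralZl_EFin//=; last 2 first.
- by move=> v _; rewrite lee_fin mulr_ge0 ?powR_ge0 ?expR_ge0.
- apply/measurable_EFinP/measurable_funTS/measurable_funM => //.
  by apply: measurableT_comp.
apply: eq_integral => v; rewrite inE/= in_itv/= andbT => v0.
have v40 : 0 < (4 * v)^-1 by rewrite invr_gt0 mulr_gt0.
(* For fixed [v] the section is [0 < t < 1/(4v)], over which [t^(s-1)] integrates to
   [(4v)^(-s) / s]; the remaining [v^(-s) e^(-v)] is the integrand of [Gamma (1 - s)]. *)
have -> : `]0, +oo[ `&` [set t | r (t, v)] = `]0, (4 * v)^-1[%classic.
  apply/seteqP; split=> t /=; rewrite !in_itv/= andbT /r/= mulrAC.
    by move=> [-> ?]; rewrite -[X in _ < X]mul1r ltr_pdivlMr ?mulr_gt0// mulrC.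
  move=> /andP[-> ?]; split=> //.
  by rewrite mulrC -ltr_pdivlMr ?mulr_gt0// mul1r.
rewrite /f/=; under eq_integral do rewrite mulrC EFinM.
rewrite ge0_integralZl_EFin//= ?expR_ge0//; last 2 first.
- by move=> t _; rewrite lee_fin powR_ge0.
- by apply/measurable_EFinP/measurable_funTS; exact: measurable_powR.
rewrite integral0_powR// -!EFinM; congr EFin.
rewrite -powR_inv1 ?mulr_ge0 ?(ltW v0)// powRAC powRM// ?(ltW v0)//.
rewrite powR_inv1 ?mulr_ge0 ?powR_ge0//.
rewrite (_ : 1 - s - 1 = - s); last by ring.
by rewrite powRN !invfM; ring.
Qed.

(* Both sides integrate [(n+1) y^n x e^(-t x^2)] over the region [0 < y < x]. *)
Lemma integral_exprS_expRN_sqr (t : R) (n : nat) : 0 < t ->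
  (\int[mu]_(x in `]0%R, +oo[) (x ^+ n.+2 * expR (- (t * x ^+ 2)))%:E =
   (n.+1%:R / (2 * t))%:E *
   \int[mu]_(x in `]0%R, +oo[) (x ^+ n * expR (- (t * x ^+ 2)))%:E)%E.
Proof.
move=> t0.
pose r (z : R * R) := z.2 < z.1.
pose f (z : R * R) := (n.+1%:R * z.2 ^+ n * (z.1 * expR (- (t * z.1 ^+ 2))))%:E.
have c0 : 0 <= n.+1%:R / (2 * t) by rewrite divr_ge0// mulr_ge0// ltW.
have me : measurable_fun setT (fun x : R => expR (- (t * x ^+ 2))).
  do 2 apply: measurableT_comp => //.
  by apply: measurable_funM => //; exact: exprn_measurable.
transitivity (\int[mu]_(x in `]0%R, +oo[)
    \int[mu]_(y in `]0%R, +oo[ `&` [set y | r (x, y)]) f (x, y))%E.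
  apply: eq_integral => x; rewrite inE/= in_itv/= andbT => x0.
  have -> : `]0, +oo[ `&` [set y | r (x, y)] = `]0, x[%classic.
    apply/seteqP; split=> y /=; rewrite !in_itv/= andbT /r/=.
      by move=> [-> ->].
    by move=> /andP[-> ->].
  (* Writing [y^n] as a real power with exponent [(n+1) - 1] brings in [integral0_powR], and the
     factor [n+1] cancels its denominator. *)
  transitivity (\int[mu]_(y in `]0%R, x[)
    ((n.+1%:R * (x * expR (- (t * x ^+ 2))))%:E * (y `^ (n.+1%:R - 1))%:E))%E.
    rewrite ge0_integralZl_EFin//=; last 3 first.
    - by move=> y _; rewrite lee_fin powR_ge0.
    - by apply/measurable_EFinP/measurable_funTS; exact: measurable_powR.
    - by rewrite !mulr_ge0 ?expR_ge0 ?ltW.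
    rewrite integral0_powR// -EFinM powR_mulrn ?ltW//; congr EFin.
    have : n.+1%:R != 0 :> R by [].
    by rewrite exprS; move: n.+1%:R (x ^+ n.+1) => c z /= c1; field.
  apply: eq_integral => y; rewrite inE/= in_itv/= => /andP[y0 _].
  rewrite -EFinM /f/= -natr1 addrK powR_mulrn ?ltW//; congr EFin.
  by ring.
rewrite ge0_tonelli_rel//=; last 3 first.
- by apply: measurable_fun_ltr.
- apply/measurable_EFinP/measurable_funM.
    apply: measurable_funM => //.
    exact: (measurableT_comp (@exprn_measurable R setT n) measurable_snd).
  by apply: measurable_funM => //; exact: (measurableT_comp me measurable_fst).
- move=> x y; rewrite !in_itv/= !andbT => x0 y0 _.
  by rewrite /f lee_fin !mulr_ge0 ?expR_ge0 ?exprn_ge0 ?ltW.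
rewrite -ge0_integralZl_EFin//=; last 2 first.
- move=> y; rewrite in_itv/= andbT => y0.
  by rewrite lee_fin mulr_ge0 ?expR_ge0 ?exprn_ge0 ?ltW.
- by apply/measurable_EFinP/measurable_funTS/measurable_funM.
apply: eq_integral => y; rewrite inE/= in_itv/= andbT => y0.
(* For fixed [y] the section is [x > y], over which [x e^(-t x^2)] integrates to
   [e^(-t y^2) / (2t)]. *)
have -> : `]0, +oo[ `&` [set x | r (x, y)] = `]y, +oo[%classic.
  apply/seteqP; split=> x /=; rewrite !in_itv/= !andbT /r/=; first by case.
  by move=> yx; split => //; exact: lt_trans yx.
rewrite /f/=; under eq_integral do rewrite EFinM.
have mxe : measurable_fun setT (fun x : R => x * expR (- (t * x ^+ 2))).
  exact: measurable_funM.
rewrite ge0_integralZl_EFin//=; last 3 first.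
- move=> x; rewrite in_itv/= andbT => yx.
  by rewrite lee_fin mulr_ge0 ?expR_ge0// ltW// (lt_trans y0).
- by apply/measurable_EFinP/measurable_funTS.
- by rewrite mulr_ge0// exprn_ge0// ltW.
rewrite integral_itv_obnd_cbnd; last by apply/measurable_EFinP/measurable_funTS.
rewrite integral_mulr_expRN_sqr ?ltW// -!EFinM; congr EFin.
by ring.
Qed.

End layer_cake.

(** * Gaussian integrals *)

(** In absolute value the cosine terms are the even terms of the exponential series at [|x|], so [n]
    of them are compared with [2n] exponential ones. The bound is uniform in [n], as dominated
    convergence requires. *)
Lemma norm_series_cos_coeff'_le {R : realType} (x : R) (n : nat) :
  `|series (cos_coeff' x) n| <= expR `|x|.
Proof.
apply: (@le_trans _ _ (series (exp_coeff `|x|) n.*2)).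
  rewrite /series/=; elim: n => [|n IHn]; first by rewrite !big_nil normr0.
  rewrite doubleS !big_nat_recr//= (le_trans (ler_normD _ _))//.
  rewrite -addrA lerD// ler_wpDr//.
    by rewrite /exp_coeff/= divr_ge0// exprn_ge0.
  rewrite /cos_coeff' /exp_coeff/= -exprnP !normrM normrX normrN1 expr1n mul1r.
  by rewrite normrX normfV normr_nat.
apply: nondecreasing_cvgn_le; last exact: is_cvg_series_exp_coeff.
apply/nondecreasing_series => i _ _.
by rewrite /exp_coeff/= divr_ge0// exprn_ge0.
Qed.

Section gaussian.
Context {R : realType}.
Local Notation mu := (@lebesgue_measure R).
Lemma integral0_expRN_sqr (t : R) : 0 < t ->
  (\int[mu]_(x in `]0%R, +oo[) (expR (- (t * x ^+ 2)))%:E =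
   ((2 * Num.sqrt t)^-1 * Num.sqrt pi)%:E)%E.
Proof.
move=> t0.
have st0 : 0 < Num.sqrt t by rewrite sqrtr_gt0.
have mg (A : set R) : measurable_fun A (EFin \o gauss_fun).
  by apply/measurable_EFinP/measurable_funTS; exact: measurable_gauss_fun.
transitivity (\int[mu]_(x in `]0%R, +oo[) (EFin \o gauss_fun) (Num.sqrt t * x)%R)%E.
  apply: eq_integral => x _.
  by rewrite /gauss_fun/= exprMn sqr_sqrtr// ltW.
rewrite ge0_integral_scale//; last by move=> x _; rewrite lee_fin gauss_fun_ge0.
rewrite integral_itv_obnd_cbnd// integral0y_gauss -EFinM; congr EFin.
by rewrite invfM; ring.
Qed.

Lemma integrable_expRN_sqr (t : R) : 0 < t ->
  mu.-integrable `]0, +oo[ (fun x : R => (expR (- (t * x ^+ 2)))%:E).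
Proof.
move=> t0; apply/integrableP; split.
  by apply/measurable_EFinP/measurable_funTS; do 3 apply: measurableT_comp => //.
under eq_integral do rewrite /= ger0_norm ?expR_ge0//.
by rewrite integral0_expRN_sqr// ltry.
Qed.

Variable t : R.
Hypothesis t0 : 0 < t.

Let G (x : R) : R := expR (- (t * x ^+ 2)).

Let mG : measurable_fun setT G.
Proof. by do 3 apply: measurableT_comp => //. Qed.

Let cG : continuous G.
Proof. exact: is_derive_continuous. Qed.

Let K : R := (2 * Num.sqrt t)^-1 * Num.sqrt pi.

(** Passing from [n] to [n+1] multiplies the moment by [(2n+1)/(2t)], which equals
    [(2n+1)(2n+2) / ((n+1) 4t)], the growth of the closed form. *)
Lemma integral0_even_moment (n : nat) :
  (\int[mu]_(x in `]0%R, +oo[) (x ^+ n.*2 * expR (- (t * x ^+ 2)))%:E =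
   ((n.*2)`!%:R / (n`!%:R * (4 * t) ^+ n) * K)%:E)%E.
Proof.
elim: n => [|n IHn].
  rewrite !fact0 expr0 mulr1 divr1 mul1r /K -(integral0_expRN_sqr t t0).
  by apply: eq_integral => x _; rewrite expr0 mul1r.
rewrite doubleS integral_exprS_expRN_sqr// IHn -EFinM; congr EFin.
rewrite !factS !natrM exprS.
have : n`!%:R != 0 :> R by rewrite pnatr_eq0 -lt0n fact_gt0.
have : (4 * t) ^+ n != 0 by rewrite expf_neq0// gt_eqF// mulr_gt0.
have -> : n.*2.+2%:R = 2 * (n.+1%:R) :> R by rewrite -doubleS -mul2n natrM.
have : n.+1%:R != 0 :> R by [].
move: (n.+1%:R) (n`!%:R) ((4 * t) ^+ n) (n.*2.+1%:R) ((n.*2)`!%:R) K.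
move=> a b c d e k a0 c0 b0; field.
by rewrite a0 b0 c0 gt_eqF.
Qed.

Let integrable_even_moment (n : nat) :
  mu.-integrable `]0, +oo[ (fun x : R => (x ^+ n.*2 * expR (- (t * x ^+ 2)))%:E).
Proof.
apply/integrableP; split.
  apply/measurable_EFinP/measurable_funTS/measurable_funM => //.
under eq_integral => x _.
  rewrite /= ger0_norm; last first.
    by rewrite mulr_ge0 ?expR_ge0// -mul2n exprM exprn_ge0// sqr_ge0.
  over.
by rewrite integral0_even_moment ltry.
Qed.

(** Integrating the cosine series termwise, the [(2i)!] of the moments cancels that of the series
    and leaves [(-1/(4t))^i / i!], an exponential series. *)
Lemma integral0_cos_expRN_sqr :
  mu.-integrable `]0, +oo[ (fun x : R => (cos x * expR (- (t * x ^+ 2)))%:E) /\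
  (\int[mu]_(x in `]0%R, +oo[) (cos x * expR (- (t * x ^+ 2)))%:E =
   (K * expR (- (4 * t)^-1))%:E)%E.
Proof.
pose f (n : nat) (x : R) := (series (cos_coeff' x) n * G x)%:E.
have fE n x : f n x = (\sum_(0 <= i < n) ((-1) ^+ i / (i.*2)`!%:R)%:E *
    (x ^+ i.*2 * G x)%:E)%E.
  rewrite /f /series/= mulr_suml -sumEFin; apply: eq_bigr => i _.
  by rewrite -EFinM /cos_coeff' -exprnP; congr EFin; ring.
(* [e^x e^(-t x^2) <= e^(1/(2t)) e^(-(t/2) x^2)], by completing the square *)
have ig : mu.-integrable `]0, +oo[ (fun x : R =>
    ((expR (2 * t)^-1)%:E * (expR (- (t / 2 * x ^+ 2)))%:E)%E).
  by apply: integrableZl => //; apply: integrable_expRN_sqr; rewrite divr_gt0.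
have [|||//||] := @dominated_convergence _ _ _ mu `]0, +oo[%classic _ f
    (fun x => (cos x * G x)%:E) _ _ _ _ ig.
- by [].
- move=> n; apply/measurable_EFinP/measurable_funTS/measurable_funM => //.
  apply: measurable_sum => i; apply: measurable_funM => //.
  exact: measurable_funM.
- apply/measurable_EFinP/measurable_funTS/measurable_funM => //.
  by apply: continuous_measurable_fun; exact: continuous_cos.
- apply: aeW => x _; apply: cvg_EFin; first by near=> n.
  by apply: cvgMl; exact: cvg_cos_coeff'.
- apply: aeW => x n; rewrite /= in_itv/= andbT => x0.
  rewrite lee_fin normrM (ger0_norm (expR_ge0 _)).
  rewrite (@le_trans _ _ (expR x * G x))//.
    rewrite ler_wpM2r ?expR_ge0// (le_trans (norm_series_cos_coeff'_le _ _))//.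
    by rewrite gtr0_norm.
  rewrite /G -!expRD ler_expR -subr_ge0.
  rewrite (_ : _ - _ = (2 * t)^-1 * (1 - t * x) ^+ 2); last first.
    by field; rewrite gt_eqF.
  by rewrite mulr_ge0 ?sqr_ge0// invr_ge0 mulr_ge0// ltW.
move=> icos _ cv; split => //; apply: (cvg_unique _ cv) => //.
(* The integrals of the partial sums are exactly [K] times partial sums of the exponential series at
   [-1/(4t)]. *)
have -> : [sequence \int[mu]_(x in `]0%R, +oo[) f n x]_n%E =
    (fun n => (K * series (exp_coeff (- (4 * t)^-1)) n)%:E).
  apply/funext => n /=; under eq_integral do rewrite fE.
  rewrite integral_sum//; last by move=> i; exact: integrableZl.
  rewrite /series/= mulr_sumr -sumEFin; apply: eq_bigr => i _.
  rewrite integralZl// integral0_even_moment -EFinM; congr EFin.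
  rewrite /exp_coeff/= (exprNn (4 * t)^-1) exprVn.
  have : i`!%:R != 0 :> R by rewrite pnatr_eq0 -lt0n fact_gt0.
  have : (i.*2)`!%:R != 0 :> R by rewrite pnatr_eq0 -lt0n fact_gt0.
  have : (4 * t) ^+ i != 0 by rewrite expf_neq0// gt_eqF// mulr_gt0.
  move: (i`!%:R) ((i.*2)`!%:R) ((4 * t) ^+ i) ((-1) ^+ i) K => a b c d k c0 b0 a0.
  by field; rewrite a0 b0 c0.
apply: cvg_EFin; first by near=> n.
by apply: cvgMr; exact: is_cvg_series_exp_coeff.
Unshelve. all: by end_near. Qed.

Let KT : 2 * K = Num.sqrt pi / Num.sqrt t.
Proof. by rewrite /K invfM; field; rewrite gt_eqF ?sqrtr_gt0. Qed.

Let integralT_even (f : R -> R) : (forall x, 0 <= f x) -> continuous f ->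
  f =1 f \o -%R ->
  (\int[mu]_x (f x)%:E = 2%:E * \int[mu]_(x in `]0%R, +oo[) (f x)%:E)%E.
Proof.
move=> f0 cf fe; rewrite ge0_symfun_integralT// integral_itv_obnd_cbnd; last first.
  by apply/measurable_EFinP/measurable_funTS; exact: continuous_measurable_fun.
by rewrite set_itvcy.
Qed.

Lemma integralT_expRN_sqr :
  (\int[mu]_x (expR (- (t * x ^+ 2)))%:E = (Num.sqrt pi / Num.sqrt t)%:E)%E.
Proof.
rewrite (integralT_even G)//.
- by rewrite integral0_expRN_sqr// -EFinM KT.
- by move=> x; exact: expR_ge0.
- by move=> x; rewrite /G/= sqrrN.
Qed.

Lemma integralT_onem_cos_expRN_sqr :
  (\int[mu]_x ((1 - cos x) * expR (- (t * x ^+ 2)))%:E =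
   (Num.sqrt pi / Num.sqrt t * (1 - expR (- (4 * t)^-1)))%:E)%E.
Proof.
rewrite (integralT_even (fun x => (1 - cos x) * G x)).
- under eq_integral do rewrite mulrBl mul1r EFinB.
  have [icos cosE] := integral0_cos_expRN_sqr.
  rewrite integralB_EFin//; last exact: integrable_expRN_sqr.
  rewrite cosE integral0_expRN_sqr// -/K -EFinB -EFinM -KT; congr EFin.
  by ring.
- by move=> x; rewrite mulr_ge0 ?expR_ge0// subr_ge0 cos_le1.
- move=> x; apply: cvgM; last exact: cG.
  by apply: cvgB; [exact: cvg_cst|exact: continuous_cos].
- by move=> x; rewrite /G/= sqrrN cosN.
Qed.

End gaussian.

(** * Gaussian integrals over R^n *)

Section lebesgue_tuple_integral.
Context {R : realType}.
Local Notation T := (measurableTypeR R).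
Local Notation mu := (@lebesgue_measure R).

(** By construction the measure in dimension [n+1] is the image of a product measure under
    [tuple_cons], so Tonelli peels off the first coordinate. *)
Lemma ge0_integral_lebesgue_tupleS (n : nat) (f : n.+1.-tuple T -> \bar R) :
  measurable_fun setT f -> (forall x, 0 <= f x)%E ->
  (\int[lebesgue_tuple n.+1]_z f z =
   \int[mu]_x \int[lebesgue_tuple n]_y f [tuple of x :: y])%E.
Proof.
move=> mf f0.
transitivity (\int[(mu \x lebesgue_tuple n)%E]_p (f \o (@tuple_cons R n)) p)%E.
  rewrite -[RHS](@ge0_integral_pushforward _ _ _ _ _ _
    (@measurable_tuple_cons R n) _ setT)//.
rewrite fubini_tonelli1//; last by move=> p; exact: f0.
by apply: measurableT_comp => //; exact: measurable_tuple_cons.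
Qed.

Lemma measurable_sum_sqr_tnth (n : nat) :
  measurable_fun setT (fun x : n.-tuple T => \sum_(i < n) tnth x i ^+ 2 : R).
Proof.
apply: measurable_sum => i; apply: measurable_funX.
exact: measurable_tnth.
Qed.

Lemma sum_sqr_tnth_cons (n : nat) (x : R) (y : n.-tuple R) :
  \sum_(i < n.+1) tnth [tuple of x :: y] i ^+ 2 =
  x ^+ 2 + \sum_(i < n) tnth y i ^+ 2.
Proof.
by rewrite big_ord_recl; congr (_ + _); apply: eq_bigr => i _; rewrite tnthS.
Qed.

Lemma measurable_gaussian_tuple (n : nat) (t : R) :
  measurable_fun setT
    (fun x : n.-tuple T => expR (- (t * \sum_(i < n) tnth x i ^+ 2)) : R).
Proof.
do 3 apply: measurableT_comp => //; exact: measurable_sum_sqr_tnth.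
Qed.

Lemma integral_gaussian_tuple (n : nat) (t : R) : 0 < t ->
  (\int[@lebesgue_tuple R n]_x (expR (- (t * \sum_(i < n) tnth x i ^+ 2)))%:E =
   ((Num.sqrt pi / Num.sqrt t) ^+ n)%:E)%E.
Proof.
move=> t0; elim: n => [|n IHn].
  (* In dimension 0 the measure is the unit mass at the empty tuple, where the Gaussian is 1. *)
  rewrite integral_dirac//; last first.
    by apply/measurable_EFinP; exact: measurable_gaussian_tuple.
  by rewrite diracT mul1e big_ord0 mulr0 oppr0 expR0.
rewrite ge0_integral_lebesgue_tupleS; last 2 first.
- by apply/measurable_EFinP; exact: measurable_gaussian_tuple.
- by move=> x; rewrite lee_fin expR_ge0.
transitivity (\int[mu]_x (((Num.sqrt pi / Num.sqrt t) ^+ n)%:E *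
    (expR (- (t * x ^+ 2)))%:E))%E.
  apply: eq_integral => x _; rewrite muleC -IHn -ge0_integralZl_EFin//; last first.
    by apply/measurable_EFinP; exact: measurable_gaussian_tuple.
  apply: eq_integral => y _.
  by rewrite sum_sqr_tnth_cons mulrDr opprD expRD EFinM.
rewrite ge0_integralZl_EFin//; last first.
  by apply/measurable_EFinP; do 3 apply: measurableT_comp => //.
by rewrite integralT_expRN_sqr// -EFinM -exprSr.
Qed.

(** Only the first coordinate meets the cosine: peeling it off leaves a pure Gaussian in the other
    [n]. *)
Lemma integral_onem_cos_gaussian_tuple (n : nat) (t : R) : 0 < t ->
  (\int[@lebesgue_tuple R n.+1]_x
     ((1 - cos (tnth x ord0)) * expR (- (t * \sum_(i < n.+1) tnth x i ^+ 2)))%:E =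
   ((Num.sqrt pi / Num.sqrt t) ^+ n.+1 * (1 - expR (- (4 * t)^-1)))%:E)%E.
Proof.
move=> t0.
have mcos : measurable_fun setT (fun x : R => 1 - cos x).
  apply: measurable_funB => //; apply: continuous_measurable_fun.
  exact: continuous_cos.
have cos0 (x : R) : 0 <= 1 - cos x by rewrite subr_ge0 cos_le1.
rewrite ge0_integral_lebesgue_tupleS; last 2 first.
- apply/measurable_EFinP/measurable_funM; last exact: measurable_gaussian_tuple.
  exact: (measurableT_comp mcos (measurable_tnth _)).
- by move=> x; rewrite lee_fin mulr_ge0 ?expR_ge0 ?cos0.
transitivity (\int[mu]_x (((Num.sqrt pi / Num.sqrt t) ^+ n)%:E *
    ((1 - cos x) * expR (- (t * x ^+ 2)))%:E))%E.
  apply: eq_integral => x _.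
  rewrite muleC -(integral_gaussian_tuple n t t0) -ge0_integralZl_EFin//; last first.
    by apply/measurable_EFinP; exact: measurable_gaussian_tuple.
  apply: eq_integral => y _.
  by rewrite sum_sqr_tnth_cons mulrDr opprD expRD -EFinM mulrA.
rewrite ge0_integralZl_EFin//; last first.
  apply/measurable_EFinP/measurable_funM => //.
  by do 3 apply: measurableT_comp => //.
by rewrite integralT_onem_cos_expRN_sqr// -EFinM mulrA -exprSr.
Qed.

End lebesgue_tuple_integral.

(** * Evaluation of the normalising integral *)

Lemma sqrtr_exprn {R : realType} (x : R) (n : nat) : 0 <= x ->
  Num.sqrt x ^+ n = x `^ (n%:R / 2).
Proof.
by move=> x0; rewrite -powR12_sqrt// -powR_mulrn ?powR_ge0// -powRrM mulrC.
Qed.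

Lemma eucl_norm_powR {R : realType} (n : nat) (x : n.-tuple R) (p : R) :
  eucl_norm x `^ (2 * p) = (\sum_(i < n) tnth x i ^+ 2) `^ p.
Proof.
rewrite powRrM powR_mulrn ?sqrtr_ge0// sqr_sqrtr//.
by apply: sumr_ge0 => i _; exact: sqr_ge0.
Qed.

(** The equality holds in the extended reals, so it also contains the convergence of the
    integral. *)
Lemma integral_onem_cos_eucl_norm {R : realType} (n : nat) (s : R) : 0 < s < 1 ->
  (\int[@lebesgue_tuple R n.+1]_x
     ((1 - cos (tnth x ord0)) / eucl_norm x `^ (n.+1%:R + 2 * s))%:E =
   (pi `^ (n.+1%:R / 2) * Gamma (1 - s) /
    (4 `^ s * s * Gamma (n.+1%:R / 2 + s)))%:E)%E.
Proof.
move=> s01; have /andP[s0 s1] := s01.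
set p := n.+1%:R / 2 + s.
have p0 : 0 < p by rewrite addr_gt0// divr_gt0.
have Gp0 := Gamma_gt0 p p0.
pose S (x : n.+1.-tuple R) := \sum_(i < n.+1) tnth x i ^+ 2.
have S0 x : 0 <= S x by apply: sumr_ge0 => i _; exact: sqr_ge0.
have onem_cos_ge0 (x : R) : 0 <= 1 - cos x by rewrite subr_ge0 cos_le1.
(* Integrating [f] over [t > 0] restores the original integrand. *)
pose f (z : n.+1.-tuple (measurableTypeR R) * measurableTypeR R) : \bar R :=
  ((Gamma p)^-1 * z.2 `^ (p - 1) *
   ((1 - cos (tnth z.1 ord0)) * expR (- (z.2 * S z.1))))%:E.
have mcos : measurable_fun setT (fun x : R => 1 - cos x).
  apply: measurable_funB => //; apply: continuous_measurable_fun.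
  exact: continuous_cos.
have mS : measurable_fun setT (S : n.+1.-tuple (measurableTypeR R) -> R).
  exact: measurable_sum_sqr_tnth.
have mcos0 : measurable_fun setT
    (fun x : n.+1.-tuple (measurableTypeR R) => 1 - cos (tnth x ord0) : R).
  exact: (measurableT_comp mcos (measurable_tnth _)).
transitivity (\int[@lebesgue_tuple R n.+1]_x
    \int[@lebesgue_measure R]_(t in `]0%R, +oo[) f (x, t))%E.
  apply: eq_integral => x _.
  rewrite (_ : n.+1%:R + 2 * s = 2 * p); last by rewrite /p; field.
  rewrite eucl_norm_powR -/(S x).
  (* at the origin, where the subordination formula fails, [1 - cos] vanishes *)
  have := S0 x; rewrite le_eqVlt => /predU1P[Sx|Sx0].
    have x0 : tnth x ord0 = 0.
      apply/eqP; rewrite -sqrf_eq0.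
      move/esym/eqP: Sx; rewrite psumr_eq0; last by move=> i _; exact: sqr_ge0.
      by move=> /allP/(_ ord0 (mem_index_enum _)).
    rewrite x0 cos0 subrr mul0r integral0_eq// => t _.
    by rewrite /f/= x0 cos0 subrr mul0r mulr0.
  transitivity (\int[@lebesgue_measure R]_(t in `]0%R, +oo[)
     (((Gamma p)^-1 * (1 - cos (tnth x ord0)))%:E *
      (t `^ (p - 1) * expR (- (S x * t)))%:E))%E.
    rewrite ge0_integralZl_EFin//=; last 3 first.
    - by move=> t _; rewrite lee_fin mulr_ge0 ?powR_ge0 ?expR_ge0.
    - apply/measurable_EFinP/measurable_funTS/measurable_funM => //.
      by do 2 apply: measurableT_comp => //.
    - by rewrite mulr_ge0// invr_ge0 ltW.
    rewrite integral_Gamma_scale// -EFinM; congr EFin.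
    by field; rewrite !gt_eqF ?powR_gt0.
  apply: eq_integral => t _; rewrite -EFinM /f/= [t * _]mulrC; congr EFin.
  by ring.
rewrite ge0_tonelli_in//=; last 2 first.
- apply/measurable_EFinP/measurable_funM.
    apply: measurable_funM => //.
    exact: (measurableT_comp (@measurable_powR R (p - 1)) measurable_snd).
  apply: measurable_funM; first exact: (measurableT_comp mcos0 measurable_fst).
  do 2 apply: measurableT_comp => //; apply: measurable_funM => //.
  exact: (measurableT_comp mS measurable_fst).
- move=> x t _ _; rewrite lee_fin !mulr_ge0 ?invr_ge0 ?powR_ge0 ?expR_ge0 ?onem_cos_ge0//.
  exact: ltW.
have c0 : 0 <= pi `^ (n.+1%:R / 2) / Gamma p by rewrite divr_ge0 ?powR_ge0 ?ltW.
(* The Gaussian integral contributes [(pi/t)^((n+1)/2)], which lowers the exponent [p - 1] to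
   [s - 1]. *)
transitivity (\int[@lebesgue_measure R]_(t in `]0%R, +oo[)
    ((pi `^ (n.+1%:R / 2) / Gamma p)%:E *
     (t `^ (s - 1) * (1 - expR (- (4 * t)^-1)))%:E))%E.
  apply: eq_integral => t; rewrite inE/= in_itv/= andbT => t0.
  rewrite /f/=; under eq_integral do rewrite EFinM.
  rewrite ge0_integralZl_EFin//; last 2 first.
  - apply/measurable_EFinP/measurable_funM => //.
    exact: measurable_gaussian_tuple.
  - by rewrite mulr_ge0 ?powR_ge0// invr_ge0 ltW.
  rewrite integral_onem_cos_gaussian_tuple// -!EFinM; congr EFin.
  rewrite expr_div_n !sqrtr_exprn ?pi_ge0 ?(ltW t0)//.
  have -> : t `^ (s - 1) = t `^ (p - 1) / t `^ (n.+1%:R / 2).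
    rewrite -powRB; last by rewrite (gt_eqF t0) implybT.
    by congr powR; rewrite /p; ring.
  by ring.
rewrite ge0_integralZl_EFin//; last 2 first.
- move=> t; rewrite /= in_itv/= andbT => t0.
  rewrite lee_fin mulr_ge0 ?powR_ge0// subr_ge0 -expR0 ler_expR.
  by rewrite oppr_le0 invr_ge0 mulr_ge0// ltW.
- apply/measurable_EFinP/measurable_funM.
    by apply: measurable_funTS; exact: measurable_powR.
  apply: measurable_funB => //; apply: measurableT_comp => //.
  (* On [t > 0] the inverse is the real power with exponent -1, whose measurability is known. *)
  apply: (@eq_measurable_fun _ _ _ _ _ (fun t : R => - (4 * t) `^ (-1))).
    move=> t; rewrite inE/= in_itv/= andbT => t0.
    by rewrite powR_inv1// mulr_ge0// ltW.
  apply: measurable_funTS; apply: measurableT_comp => //.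
  by apply: (measurableT_comp (@measurable_powR R (-1))).
rewrite integral_powR_onem_expRN// -EFinM; congr EFin.
by field; rewrite !gt_eqF ?powR_gt0.
Qed.

Theorem theorem3p5 (R : realType) (n : nat) (s : R) :
  (1 <= n)%N -> 0 < s < 1 ->
  C n s = 2 `^ (2 * s) * s * Gamma (n%:R / 2 + s)
          / (pi `^ (n%:R / 2) * Gamma (1 - s)).
Proof.
case: n => // n _ s01; have /andP[s0 s1] := s01.
rewrite /C /Rintegral.
under eq_integral do rewrite -[_`_0](tnth_nth 0 _ ord0).
rewrite integral_onem_cos_eucl_norm//=.
(* [2^(2s)] becomes [4^s], the form produced by the integral. *)
rewrite [2 `^ _]powRrM powR_mulrn// -natrX.
by rewrite invfM invrK; ring.
Qed.
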